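(* Let $\alpha,\beta\in(0,1)$ with $\alpha+\beta<1$, and let $f$ be an $L^1$ function. Write $I^{\nu}={}^{RL}I^{\nu}_{0+}$. The semigroup property $$ {}^{AB}I^{\alpha}_{0+}\Big({}^{AB}I^{\beta}_{0+}f(t)\Big)={}^{AB}I^{\alpha+\beta}_{0+}f(t) $$ holds if and only if $$ \bigg[\frac{\alpha\beta}{B(\alpha)B(\beta)}-\frac{\alpha+\beta}{B(\alpha+\beta)}\bigg]I^{\alpha+\beta}f+\frac{\alpha(1-\beta)}{B(\alpha)B(\beta)}I^{\alpha}f+\frac{\beta(1-\alpha)}{B(\alpha)B(\beta)}I^{\beta}f+\bigg[\frac{(1-\alpha)(1-\beta)}{B(\alpha)B(\beta)}-\frac{1-\alpha-\beta}{B(\alpha+\beta)}\bigg]f=0. $$ If moreover the normalisation function satisfies $B(\alpha)B(\beta)=B(\alpha+\beta)$, then this condition is equivalent to $$ \Big[(\alpha-1)I^{\beta}-\alpha\Big]\Big[(\beta-1)I^{\alpha}-\beta\Big]f=I^{\alpha+\beta}f. $$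
   Context: $B$ is a fixed normalisation function with real, strictly positive values and $B(0)=B(1)=1$. The Riemann--Liouville fractional integral of order $\nu>0$ is ${}^{RL}I^{\nu}_{0+}f(t)=\frac{1}{\Gamma(\nu)}\int_0^t(t-\tau)^{\nu-1}f(\tau)\,\mathrm{d}\tau$. For $\alpha\in(0,1)$ the AB fractional integral is ${}^{AB}I^{\alpha}_{0+}f(t)=\frac{1-\alpha}{B(\alpha)}f(t)+\frac{\alpha}{B(\alpha)}{}^{RL}I^{\alpha}_{0+}f(t)$. *)

(* Defs.v *)
From HB Require Import structures.
From mathcomp Require Import all_boot all_order all_algebra.
From mathcomp Require Import all_classical all_reals all_analysis.
Set Implicit Arguments.
Unset Strict Implicit.
Unset Printing Implicit Defensive.
Import Order.TTheory GRing.Theory Num.Theory.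
Import numFieldNormedType.Exports.
Local Open Scope classical_set_scope.
Local Open Scope ring_scope.

Definition Gamma (R : realType) (x : R) : R :=
  \int[lebesgue_measure]_(s in `]0, +oo[) (s `^ (x - 1) * expR (- s)).

(* For f of class L^1 the integrand is integrable only for almost every t;
   at the other t the value is a default one, so these operators are
   meaningful up to a.e. equality. *)
Definition RLint (R : realType) (nu : R) (f : R -> R) (t : R) : R :=
  (Gamma nu)^-1 *
  \int[lebesgue_measure]_(tau in `[0, t]) ((t - tau) `^ (nu - 1) * f tau).

Definition ABint (R : realType) (B : R -> R) (alpha : R) (f : R -> R) (t : R)
    : R :=
  (1 - alpha) / B alpha * f t + alpha / B alpha * RLint alpha f t.

Definition normalisation (R : realType) (B : R -> R) : Prop :=
  [/\ forall x, x \in `[0, 1] -> 0 < B x, B 0 = 1 & B 1 = 1].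

(* The time domain, of finite length T or, for T = +oo, the half-line.
   Whether the endpoints belong to it is irrelevant up to a.e. equality. *)
Definition time_domain (R : realType) (T : \bar R) : set R :=
  [set t | 0 < t /\ (t%:E < T)%E].

(* The operator c I^nu - d. *)
Definition RLaffine (R : realType) (c nu d : R) (g : R -> R) (t : R) : R :=
  c * RLint nu g t - d * g t.

(* Main.v *)
Require Import Defs.
From HB Require Import structures.
From mathcomp Require Import all_boot all_order all_algebra.
From mathcomp Require Import all_classical all_reals all_analysis.
From mathcomp Require Import measurable_realfun ring lra.
Import Order.TTheory GRing.Theory Num.Theory.
Import numFieldNormedType.Exports.
Local Open Scope classical_set_scope.
Local Open Scope ring_scope.

(** Both equivalences are linear algebra over the semigroup law
    I^a (I^b f) = I^(a + b) f, which holds a.e. for integrable f: with it, the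
    difference of the two sides of the AB semigroup property is, a.e., the
    linear combination in the condition; and when B(a) B(b) = B(a + b), this
    combination times B(a + b) is the difference of the two sides of the
    factorised equation (lemma [ae_RLint_linear]).

    The semigroup law comes from convolution. Multiplying by exp(-t) turns the
    locally integrable kernel s^(nu - 1) / Gamma(nu) into the density of the
    Gamma distribution with shape nu, so that
      exp(-t) I^nu f (t) = (gamma_density nu * F) (t),
    where F is exp(-s) f(s) on the time domain and 0 elsewhere
    ([RLint_rconv]). Thus everything takes place in the convolution algebra of
    integrable functions on the whole line, uniformly for a bounded and an
    unbounded time domain. Two facts remain.
    - Convolution is associative. For nonnegative functions this is Tonelli's
      theorem together with translation invariance ([econvA]); signed functions
      are reduced to it a.e. through their positive and negative parts
      ([ae_rconvA]).
    - Gamma densities form a convolution semigroup ([econv_gamma_density]).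
      Rescaling the variable shows that the convolution of the unnormalised
      kernels a and b is a constant multiple of the kernel a + b, and comparing
      total masses shows that the constant is
      Gamma(a) Gamma(b) / Gamma(a + b), without evaluating the Beta
      integral. *)

Set Implicit Arguments.
Unset Strict Implicit.
Unset Printing Implicit Defensive.

(** * Affine changes of variable *)

Section affine.
Context (R : realType).
Notation mu := (@lebesgue_measure R).
Local Open Scope ereal_scope.

Lemma measurable_affine (c d : R) :
  measurable_fun setT
    (fun s : measurableTypeR R => (c * s + d)%R : measurableTypeR R).
Proof. by apply: measurable_funD => //; exact: measurable_funM. Qed.

Lemma preimage_affine_itv (c d a b : R) : (0 < c)%R ->
  (fun s : R => (c * s + d)%R) @^-1` `]a, b]%classic =
  `]((a - d) / c)%R, ((b - d) / c)%R]%classic.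
Proof.
move=> c0; apply/seteqP; split => s /=; rewrite !in_itv/=.
  by rewrite ltr_pdivrMr// ler_pdivlMr// (mulrC s); lra.
by rewrite ltr_pdivrMr// ler_pdivlMr// (mulrC s); lra.
Qed.

(** Both sides are measures in A, so by uniqueness of Lebesgue measure it is
    enough to compare them on half-open intervals. *)
Lemma lebesgue_measure_affine (c d : R) (A : set (measurableTypeR R)) :
  (0 < c)%R -> measurable A ->
  mu A = c%:E * mu ((fun s : R => (c * s + d)%R) @^-1` A).
Proof.
move=> c0 mA.
pose phi (s : measurableTypeR R) : measurableTypeR R := (c * s + d)%R.
have mphi : measurable_fun setT phi by exact: measurable_affine.
pose P := isMeasurableFun.Build _ _ _ _ _ mphi.
pose phi' : {mfun _ >-> _} := HB.pack phi P.
pose k : {nonneg R} := NngNum (ltW c0).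
apply: (@lebesgue_measure_unique _ (mscale k (pushforward mu phi'))) => //.
move=> X [[a b] _ <-] /=.
rewrite /mscale/= /pushforward preimage_affine_itv// !lebesgue_measure_itv/=.
rewrite !lte_fin ltr_pM2r ?invr_gt0// ltrBlDr subrK.
case: ifPn => _; last by rewrite mule0.
rewrite -!EFinD -EFinM; congr EFin.
by field; rewrite gt_eqF.
Qed.

Lemma integral_affine (c d : R) (f : R -> \bar R) : (0 < c)%R ->
  measurable_fun setT f -> (forall s, 0 <= f s) ->
  \int[mu]_s f s = c%:E * \int[mu]_s f (c * s + d)%R.
Proof.
move=> c0 mf f0.
pose phi (s : measurableTypeR R) : measurableTypeR R := (c * s + d)%R.
have mphi : measurable_fun setT phi by exact: measurable_affine.
pose P := isMeasurableFun.Build _ _ _ _ _ mphi.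
pose phi' : {mfun _ >-> _} := HB.pack phi P.
pose k : {nonneg R} := NngNum (ltW c0).
rewrite (eq_measure_integral (mscale k (pushforward mu phi'))); last first.
  by move=> A mA _; exact: lebesgue_measure_affine.
rewrite ge0_integral_mscale// ge0_integral_pushforward//.
Qed.

End affine.

(** * Convolution of nonnegative functions *)

Section nonneg_convolution.
Context (R : realType).
Notation mu := (@lebesgue_measure R).
Local Open Scope ereal_scope.
Implicit Types f g h : R -> \bar R.

Definition econv f g (t : R) : \bar R := \int[mu]_s (f (t - s)%R * g s).

Lemma econv_ge0 f g t : (forall s, 0 <= f s) -> (forall s, 0 <= g s) ->
  0 <= econv f g t.
Proof. by move=> f0 g0; apply: integral_ge0 => s _; exact: mule_ge0. Qed.

Lemma measurable_econv_integrand f g :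
  measurable_fun setT f -> measurable_fun setT g ->
  measurable_fun setT
    (fun z : measurableTypeR R * measurableTypeR R => f (z.1 - z.2)%R * g z.2).
Proof.
move=> mf mg; apply: emeasurable_funM.
  by apply: (measurableT_comp mf); exact: measurable_funB.
exact: measurableT_comp.
Qed.

Lemma measurable_econv_section f g (t : R) :
  measurable_fun setT f -> measurable_fun setT g ->
  measurable_fun setT (fun s : measurableTypeR R => f (t - s)%R * g s).
Proof.
move=> mf mg; apply: emeasurable_funM => //.
by apply: (measurableT_comp mf); exact: measurable_funB.
Qed.

Lemma measurable_econv f g :
  measurable_fun setT f -> measurable_fun setT g ->
  (forall s, 0 <= f s) -> (forall s, 0 <= g s) ->
  measurable_fun setT (econv f g).
Proof.
move=> mf mg f0 g0.
apply: (measurable_fun_fubini_tonelli_F (m2 := mu)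
  (fun z : measurableTypeR R * measurableTypeR R => f (z.1 - z.2)%R * g z.2)).
  exact: measurable_econv_integrand.
by move=> z; exact: mule_ge0.
Qed.

Lemma integral_shift f (d : R) :
  measurable_fun setT f -> (forall s, 0 <= f s) ->
  \int[mu]_s f (s - d)%R = \int[mu]_s f s.
Proof.
move=> mf f0; rewrite [RHS](@integral_affine _ 1%R (- d)%R)// mul1e.
by apply: eq_integral => s _; rewrite mul1r.
Qed.

Lemma integral_econv f g :
  measurable_fun setT f -> measurable_fun setT g ->
  (forall s, 0 <= f s) -> (forall s, 0 <= g s) ->
  \int[mu]_t econv f g t = (\int[mu]_s f s) * (\int[mu]_s g s).
Proof.
move=> mf mg f0 g0.
rewrite /econv (@fubini_tonelli _ _ _ _ _ mu mu
  (fun z : measurableTypeR R * measurableTypeR R => f (z.1 - z.2)%R * g z.2))/=;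
  [|exact: measurable_econv_integrand|by move=> z; exact: mule_ge0].
rewrite -ge0_integralZl//; last exact: integral_ge0.
apply: eq_integral => s _.
rewrite ge0_integralZr//; last first.
  by apply: (measurableT_comp mf); exact: measurable_funB.
by rewrite integral_shift.
Qed.

(** After Tonelli's theorem the inner integral is, for fixed u, the convolution
    of f and g at t - u up to the translation by u. *)
Lemma econvA f g h :
  measurable_fun setT f -> measurable_fun setT g -> measurable_fun setT h ->
  (forall s, 0 <= f s) -> (forall s, 0 <= g s) -> (forall s, 0 <= h s) ->
  econv f (econv g h) = econv (econv f g) h.
Proof.
move=> mf mg mh f0 g0 h0; apply/funext => t.
transitivity (\int[mu]_s \int[mu]_u (f (t - s)%R * (g (s - u)%R * h u))).
  apply: eq_integral => s _; rewrite ge0_integralZl//.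
    exact: measurable_econv_section.
  by move=> u _; exact: mule_ge0.
rewrite (@fubini_tonelli _ _ _ _ _ mu mu
  (fun z : measurableTypeR R * measurableTypeR R =>
     f (t - z.1)%R * (g (z.1 - z.2)%R * h z.2)))/=; last 2 first.
- apply: emeasurable_funM; last exact: measurable_econv_integrand.
  by apply: (measurableT_comp mf); exact: measurable_funB.
- by move=> z; rewrite !mule_ge0.
apply: eq_integral => u _.
under eq_integral do rewrite muleA.
rewrite ge0_integralZr//; last first.
- by move=> s _; exact: mule_ge0.
- apply: emeasurable_funM.
    by apply: (measurableT_comp mf); exact: measurable_funB.
  by apply: (measurableT_comp mg); exact: measurable_funB.
congr (_ * _); rewrite [RHS]/econv.
rewrite -(@integral_shift (fun s => f (t - u - s)%R * g s) u); last 2 first.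
- exact: measurable_econv_section.
- by move=> s; exact: mule_ge0.
by apply: eq_integral => s _; rewrite (_ : (t - u - (s - u) = t - s)%R)//; lra.
Qed.

End nonneg_convolution.

(** * The Gamma integral *)

Section gamma_integral.
Context (R : realType).
Notation mu := (@lebesgue_measure R).
(** The power is cut off on the negative half-line so that convolving with it
    over the whole line integrates only over the past. *)
Definition powR_pos (a s : R) : R := if 0 < s then s `^ (a - 1) else 0.

Definition gamma_kernel (a s : R) : R := powR_pos a s * expR (- s).

Lemma powR_pos_ge0 (a s : R) : 0 <= powR_pos a s.
Proof. by rewrite /powR_pos; case: ifP => // _; exact: powR_ge0. Qed.

Lemma gamma_kernel_ge0 (a s : R) : 0 <= gamma_kernel a s.
Proof. by rewrite mulr_ge0 ?powR_pos_ge0 ?expR_ge0. Qed.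

Lemma measurable_powR_pos a : measurable_fun setT (powR_pos a).
Proof.
apply: measurable_fun_ifT => //; first exact: measurable_fun_ltr.
Qed.

Lemma measurable_gamma_kernel a : measurable_fun setT (gamma_kernel a).
Proof.
apply: measurable_funM; first exact: measurable_powR_pos.
by apply: measurableT_comp => //; exact: measurable_expR.
Qed.

Lemma integral_powR_itv (a e : R) : 0 < a -> 0 < e < 1 ->
  (\int[mu]_(s in `[e, 1%R]) (s `^ (a - 1))%:E <= a^-1%:E)%E.
Proof.
move=> a0 /andP[e0 e1].
have D (x : R) : 0 < x ->
    is_derive x 1 (fun y : R => a^-1 * y `^ a) (x `^ (a - 1)).
  move=> x0; have := is_deriveZ a^-1 (is_derive1_powR a x0).
  by rewrite /GRing.scale/= mulrA mulVf ?gt_eqF// mul1r.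
have C (b x : R) : 0 < x -> {for x, continuous (fun y : R => y `^ b)}.
  move=> x0; apply: differentiable_continuous; apply/derivable1_diffP.
  by case: (is_derive1_powR b x0).
have CF (x : R) : 0 < x -> {for x, continuous (fun y : R => a^-1 * y `^ a)}.
  move=> x0; apply: differentiable_continuous; apply/derivable1_diffP.
  by case: (D x x0).
rewrite (@continuous_FTC2 _ _ (fun y => a^-1 * y `^ a))//.
- rewrite powR1 mulr1 -EFinB lee_fin lerBlDr lerDl.
  by rewrite mulr_ge0 ?invr_ge0 ?(ltW a0)// powR_ge0.
- apply: continuous_in_subspaceT => x; rewrite inE/= in_itv/= => /andP[ex _].
  by apply: C; exact: lt_le_trans ex.
- split.
  + by move=> x; rewrite in_itv/= => /andP[ex _]; case: (D x (lt_trans e0 ex)).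
  + by apply: cvg_at_right_filter; exact: CF.
  + by apply: cvg_at_left_filter; exact: CF.
- move=> x; rewrite in_itv/= => /andP[ex _].
  by rewrite derive1E; case: (D x (lt_trans e0 ex)).
Qed.

(** Truncate away from the singularity, where the fundamental theorem of
    calculus gives the uniform bound 1 / a, then let the cut-off tend to 0. *)
Lemma integral_powR_01 (a : R) : 0 < a ->
  (\int[mu]_(s in `]0%R, 1%R]) (s `^ (a - 1))%:E <= a^-1%:E)%E.
Proof.
move=> a0.
have -> : `]0, 1]%classic = \bigcup_n `[(n.+2%:R)^-1, 1 : R]%classic.
  apply/seteqP; split => x /=; last first.
    case=> n _ /=; rewrite !in_itv/= => /andP[+ ->]; rewrite andbT.
    exact: lt_le_trans.
  rewrite in_itv/= => /andP[x0 x1].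
  (* The cut-offs are 1 / (n + 2), strictly below the upper bound 1. *)
  exists (Num.truncn x^-1) => //=; rewrite in_itv/= x1 andbT.
  rewrite -[leRHS]invrK lef_pV2 ?posrE ?invr_gt0//.
  apply: (le_trans (ltW (truncnS_gt _))).
  by rewrite ler_nat.
pose f (s : measurableTypeR R) : \bar R := (s `^ (a - 1))%:E.
have mf D : measurable_fun D f.
  by apply: measurable_funTS; apply/measurable_EFinP; exact: measurable_powR.
pose E n : set (measurableTypeR R) := `[(n.+2%:R)^-1, 1 : R]%classic.
have mE n : measurable (E n) by exact: measurable_itv.
have H : (\int[mu]_(s in E n) f s @[n --> \oo] -->
    \int[mu]_(s in \bigcup_n E n) f s)%E.
  apply: ge0_nondecreasing_set_cvg_integral => //.
  - move=> m n mn; apply/subsetPset => x; rewrite /E/= !in_itv/= => /andP[+ ->].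
    rewrite andbT; apply: le_trans.
    by rewrite lef_pV2 ?posrE ?ltr0n// ler_nat.
  - by move=> n x _; rewrite /f lee_fin powR_ge0.
rewrite -(cvg_lim _ H)//; apply: lime_le.
  by apply/cvg_ex; eexists; exact: H.
near=> n; apply: integral_powR_itv => //.
by rewrite invr_gt0 ltr0n/= invf_lt1 ?ltr0n// ltr1n.
Unshelve. all: end_near. Qed.

Lemma integral_gamma_kernelE (a : R) :
  (\int[mu]_s (gamma_kernel a s)%:E =
   \int[mu]_(s in `]0%R, +oo[) (s `^ (a - 1) * expR (- s))%:E)%E.
Proof.
rewrite [RHS]integral_mkcond; apply: eq_integral => s _.
rewrite patchE /gamma_kernel /powR_pos mem_setE in_itv/= andbT.
by case: ifP => // _; rewrite mul0r.
Qed.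

(** Dominate by the power near 0, where the exponential is at most 1, and by
    the exponential after 1, where the power is at most 1. *)
Lemma integral_gamma_kernel_lty (a : R) : 0 < a <= 1 ->
  (\int[mu]_s (gamma_kernel a s)%:E < +oo)%E.
Proof.
move=> /andP[a0 a1].
rewrite integral_gamma_kernelE (@itv_bndbnd_setU _ _ _ (BRight 1)) ?bnd_simp//.
have m D : measurable_fun D
    (fun s : measurableTypeR R => (s `^ (a - 1) * expR (- s))%:E).
  apply: measurable_funTS; apply/measurable_EFinP; apply: measurable_funM.
    exact: measurable_powR.
  by apply: measurableT_comp => //; exact: measurable_expR.
rewrite ge0_integral_setU//=; last 2 first.
- by move=> s _; rewrite lee_fin mulr_ge0 ?powR_ge0 ?expR_ge0.
- apply/disj_setPS => s [] /=; rewrite !in_itv/= => /andP[_ s1].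
  by rewrite andbT ltNge s1.
apply: lte_add_pinfty.
- apply: (@le_lt_trans _ _ (a^-1)%:E); last exact: ltry.
  apply: (le_trans _ (integral_powR_01 a0)).
  apply: ge0_le_integral => //.
  + by move=> s _; rewrite lee_fin mulr_ge0 ?powR_ge0 ?expR_ge0.
  + by apply: measurable_funTS; apply/measurable_EFinP; exact: measurable_powR.
  + move=> s /=; rewrite in_itv/= => /andP[s0 _].
    rewrite lee_fin ler_piMr ?powR_ge0// -expR0 ler_expR; lra.
- apply: (@le_lt_trans _ _ 1%E); last exact: ltry.
  rewrite -(@integral_exponential_pdf R 1)// [leLHS]integral_mkcond.
  apply: ge0_le_integral => //.
  + move=> s _; rewrite patchE; case: ifP => // _.
    by rewrite lee_fin mulr_ge0 ?powR_ge0 ?expR_ge0.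
  + by apply/(measurable_restrictT _ _).1 => //.
  + by apply/measurable_EFinP; exact: measurable_exponential_pdf.
  + move=> s _; rewrite patchE mem_setE in_itv/= andbT.
    case: ifPn => [s1|_]; last by rewrite lee_fin exponential_pdf_ge0.
    have s0 : 0 <= s by rewrite (le_trans ler01)// ltW.
    rewrite lee_fin exponential_pdfE// mul1r mulN1r ler_piMl ?expR_ge0//.
    by rewrite -[leRHS](powRr0 s) ler_powR ?(ltW s1)//; lra.
Qed.

Lemma EFin_Gamma (a : R) : 0 < a <= 1 ->
  ((Gamma a)%:E = \int[mu]_s (gamma_kernel a s)%:E)%E.
Proof.
move=> a01; rewrite /Gamma /Rintegral -integral_gamma_kernelE fineK//.
rewrite ge0_fin_numE; last first.
  by apply: integral_ge0 => s _; rewrite lee_fin gamma_kernel_ge0.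
exact: integral_gamma_kernel_lty.
Qed.

(** On (0, 1] the kernel is at least exp(-1). *)
Lemma Gamma_gt0 (a : R) : 0 < a <= 1 -> 0 < Gamma a.
Proof.
move=> a01; have /andP[a0 a1] := a01.
apply: (@lt_le_trans _ _ (expR (- 1))); first exact: expR_gt0.
rewrite -lee_fin EFin_Gamma//.
have -> : ((expR (- 1))%:E = \int[mu]_(s in `]0%R, 1%R]) (expR (- 1 : R))%:E)%E.
  rewrite integral_cst//.
  rewrite [X in (_ * X)%E](_ : _ = 1%E) ?mule1//.
  by rewrite [LHS]lebesgue_measure_itv/= lte_fin ltr01 oppr0 adde0.
rewrite [leLHS]integral_mkcond; apply: ge0_le_integral => //.
- by move=> s _; rewrite patchE; case: ifP => // _; rewrite lee_fin expR_ge0.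
- by apply/(measurable_restrictT _ _).1 => //.
- by apply/measurable_EFinP; exact: measurable_gamma_kernel.
- move=> s _; rewrite patchE mem_setE in_itv/=.
  case: ifPn => [/andP[s0 s1]|_]; last by rewrite lee_fin gamma_kernel_ge0.
  rewrite lee_fin /gamma_kernel /powR_pos s0 -[leLHS]mul1r ler_pM ?expR_ge0//.
    by rewrite -[leLHS](powRr0 s) ger_powR ?s0//; lra.
  by rewrite ler_expR; lra.
Qed.

End gamma_integral.

(** * The convolution semigroup of Gamma densities *)

Section gamma_convolution.
Context (R : realType).
Notation mu := (@lebesgue_measure R).
Lemma powR_posM (a x u : R) : 0 < x ->
  powR_pos a (x * u) = x `^ (a - 1) * powR_pos a u.
Proof.
move=> x0; rewrite /powR_pos pmulr_rgt0//; case: ifP => [u0|_].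
  by rewrite powRM// ltW.
by rewrite mulr0.
Qed.

(** The substitution s = x u takes all dependence on x out of the integral; the
    exponentials multiply to exp(-x). The remaining factor is the Beta integral,
    possibly infinite at this point. *)
Lemma econv_gamma_kernel_homogeneous (a b x : R) :
  (econv (EFin \o gamma_kernel a) (EFin \o gamma_kernel b) x =
   (\int[mu]_u (powR_pos a (1 - u) * powR_pos b u)%:E) *
   (gamma_kernel (a + b) x)%:E)%E.
Proof.
have [x0|x0] := leP x 0.
  rewrite /gamma_kernel [X in (_ * (X * _)%:E)%E]/powR_pos.
  rewrite ltNge x0/= mul0r mule0.
  apply: integral0_eq => s _ /=; rewrite -EFinM; congr EFin.
  rewrite /gamma_kernel /powR_pos; case: ifPn => [xs|_]; last by rewrite !mul0r.
  rewrite [X in _ * (X * _)](_ : _ = 0) ?mul0r ?mulr0// ifF//.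
  by apply/negbTE; rewrite -leNgt; lra.
have mp (c : R) :
    measurable_fun setT (fun u : measurableTypeR R => powR_pos a (c - u)).
  by apply: measurableT_comp; [exact: measurable_powR_pos|exact: measurable_funB].
rewrite /econv (@integral_affine _ x 0)//; last 2 first.
- apply: measurable_econv_section;
    by apply/measurable_EFinP; exact: measurable_gamma_kernel.
- by move=> s; rewrite -EFinM lee_fin mulr_ge0 ?gamma_kernel_ge0.
transitivity (x%:E * \int[mu]_u ((x `^ (a - 1) * x `^ (b - 1) * expR (- x))%:E *
   (powR_pos a (1 - u) * powR_pos b u)%:E))%E.
  congr (_ * _)%E; apply: eq_integral => u _ /=; rewrite -!EFinM; congr EFin.
  rewrite /gamma_kernel addr0 (_ : x - x * u = x * (1 - u)); last by ring.
  rewrite !powR_posM// (_ : - x = - (x * (1 - u)) + - (x * u)); last by ring.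
  by rewrite expRD; ring.
rewrite ge0_integralZl//; last 3 first.
- apply/measurable_EFinP; apply: measurable_funM => //.
  exact: measurable_powR_pos.
- by move=> u _; rewrite lee_fin mulr_ge0 ?powR_pos_ge0.
- by rewrite lee_fin !mulr_ge0 ?powR_ge0 ?expR_ge0.
rewrite muleA muleC -EFinM; congr (_ * _%:E)%E.
rewrite /gamma_kernel /powR_pos x0 !mulrA; congr (_ * _).
have xn0 c d : (c + d == 0) ==> (x != 0) by rewrite gt_eqF// implybT.
rewrite -[X in X * _ * _](powRr1 (ltW x0)) -!powRD ?xn0//.
by congr (_ `^ _); ring.
Qed.

Definition gamma_density (a s : R) : R := (Gamma a)^-1 * gamma_kernel a s.

Lemma gamma_density_ge0 (a s : R) : 0 < a <= 1 -> 0 <= gamma_density a s.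
Proof.
by move=> a01; rewrite mulr_ge0 ?gamma_kernel_ge0// invr_ge0 ltW// Gamma_gt0.
Qed.

Lemma measurable_gamma_density (a : R) : measurable_fun setT (gamma_density a).
Proof. by apply: measurable_funM => //; exact: measurable_gamma_kernel. Qed.

Lemma integral_gamma_density (a : R) : 0 < a <= 1 ->
  (\int[mu]_s (gamma_density a s)%:E = 1)%E.
Proof.
move=> a01; have G0 := Gamma_gt0 a01.
under eq_integral do rewrite EFinM.
rewrite ge0_integralZl//; last 3 first.
- by apply/measurable_EFinP; exact: measurable_gamma_kernel.
- by move=> s _; rewrite lee_fin gamma_kernel_ge0.
- by rewrite lee_fin invr_ge0 ltW.
by rewrite -EFin_Gamma// -EFinM mulVf// gt_eqF.
Qed.

(** Integrating [econv_gamma_kernel_homogeneous] over x determines the unknown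
    constant, because the mass of a convolution is the product of the masses. *)
Lemma econv_gamma_kernel (a b : R) : 0 < a -> 0 < b -> a + b <= 1 ->
  econv (EFin \o gamma_kernel a) (EFin \o gamma_kernel b) =
  (fun x => (Gamma a * Gamma b / Gamma (a + b) * gamma_kernel (a + b) x)%:E).
Proof.
move=> a0 b0 ab1; apply/funext => x.
have a01 : 0 < a <= 1 by lra.
have b01 : 0 < b <= 1 by lra.
have ab01 : 0 < a + b <= 1 by lra.
have G0 := Gamma_gt0 ab01.
have mk (c : R) : measurable_fun setT (EFin \o gamma_kernel c).
  by apply/measurable_EFinP; exact: measurable_gamma_kernel.
have k0 (c s : R) : (0 <= (EFin \o gamma_kernel c) s)%E.
  by rewrite lee_fin gamma_kernel_ge0.
have := integral_econv (mk a) (mk b) (k0 a) (k0 b).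
under eq_integral do rewrite econv_gamma_kernel_homogeneous.
rewrite ge0_integralZl; last 4 first.
- exact: measurableT.
- exact: mk.
- by move=> s _; exact: k0.
- by apply: integral_ge0 => u _; rewrite lee_fin mulr_ge0 ?powR_pos_ge0.
rewrite -!EFin_Gamma// => CE.
rewrite econv_gamma_kernel_homogeneous [RHS]EFinM; congr (_ * _)%E.
rewrite EFinM EFinM -CE -muleA -EFinM divff ?mule1// gt_eqF//.
Qed.

Lemma econv_gamma_density (a b : R) : 0 < a -> 0 < b -> a + b <= 1 ->
  econv (EFin \o gamma_density a) (EFin \o gamma_density b) =
  EFin \o gamma_density (a + b).
Proof.
move=> a0 b0 ab1; apply/funext => x.
have a01 : 0 < a <= 1 by lra.
have b01 : 0 < b <= 1 by lra.
have Ga0 := Gamma_gt0 a01.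
have Gb0 := Gamma_gt0 b01.
transitivity (((Gamma a)^-1 * (Gamma b)^-1)%:E *
    econv (EFin \o gamma_kernel a) (EFin \o gamma_kernel b) x)%E.
  rewrite /econv -ge0_integralZl//; last 3 first.
  - by apply: measurable_econv_section;
      apply/measurable_EFinP; exact: measurable_gamma_kernel.
  - by move=> s _; rewrite -EFinM lee_fin mulr_ge0 ?gamma_kernel_ge0.
  - by rewrite lee_fin; apply: mulr_ge0; rewrite invr_ge0 ltW.
  apply: eq_integral => s _ /=; rewrite -!EFinM; congr EFin.
  by rewrite /gamma_density mulrACA.
rewrite econv_gamma_kernel// -EFinM /= /gamma_density; congr EFin.
have Gab0 : 0 < Gamma (a + b) by apply: Gamma_gt0; lra.
move: (Gamma a) (Gamma b) (Gamma _) (gamma_kernel _ x) Ga0 Gb0 Gab0.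
move=> u v w k u0 v0 w0.
by field; rewrite !gt_eqF.
Qed.

End gamma_convolution.

(** * Convolution of integrable functions *)

(** The points are typed in R itself rather than in its measurable copy, as in
    the pointwise statements below. *)
#[local] Instance lebesgue_ae_filter (R : realType) :
  @Filter R (nbhs (almost_everywhere (@lebesgue_measure R))).
Proof.
exact: (@ae_filter_ringOfSetsType _ (measurableTypeR R) R
  (@lebesgue_measure R)).
Qed.

Section real_convolution.
Context (R : realType).
Notation mu := (@lebesgue_measure R).
Notation L1 f := (mu.-integrable setT (EFin \o f)).
Implicit Types k f g : R -> R.

Definition rconv k f (t : R) : R := \int[mu]_s (k (t - s) * f s).

Lemma L1_measurable f : L1 f -> measurable_fun setT f.
Proof. by move=> /measurable_int /measurable_EFinP. Qed.

Lemma measurable_rconv_section k f (t : R) :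
  measurable_fun setT k -> measurable_fun setT f ->
  measurable_fun setT (fun s : measurableTypeR R => k (t - s) * f s).
Proof.
move=> mk mf; apply: measurable_funM => //.
by apply: (measurableT_comp mk); exact: measurable_funB.
Qed.

Lemma L1_econv (u v : R -> \bar R) :
  (forall s, (0 <= u s)%E) -> (forall s, (0 <= v s)%E) ->
  mu.-integrable setT u -> mu.-integrable setT v ->
  mu.-integrable setT (econv u v).
Proof.
move=> u0 v0 iu iv.
have mu_ := measurable_int _ iu; have mv := measurable_int _ iv.
apply/integrableP; split; first exact: measurable_econv.
under eq_integral do rewrite gee0_abs ?econv_ge0//.
rewrite integral_econv// lte_mul_pinfty//.
- exact: integral_ge0.
- exact: integrable_fin_num.
- exact: integrable_lty.
Qed.

(** The convolution of the absolute values has finite integral, hence is finite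
    almost everywhere. *)
Lemma ae_rconv_integrable k f : (forall s, 0 <= k s) -> L1 k -> L1 f ->
  {ae mu, forall t : R, L1 (fun s : R => k (t - s) * f s)}.
Proof.
move=> k0 ik if_.
have mk := L1_measurable ik; have mf := L1_measurable if_.
have H : mu.-integrable setT (econv (EFin \o k) (EFin \o (Num.norm \o f))).
  apply: L1_econv => //; last exact: integrable_norm.
  by move=> s; rewrite lee_fin/=.
apply: filterS (integrable_ae _ H) => // t /(_ I) fint.
apply/integrableP; split.
  by apply/measurable_EFinP; exact: measurable_rconv_section.
have {}fint : (econv (EFin \o k) (EFin \o (Num.norm \o f)) t < +oo)%E.
  by rewrite ltey_eq fint.
apply: le_lt_trans fint; rewrite le_eqVlt; apply/orP; left; apply/eqP.
by apply: eq_integral => s _ /=; rewrite normrM ger0_norm.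
Qed.

(** Holds at every t, including those where the integral diverges: the integral
    is defined as this difference. Measurability of the convolution follows. *)
Lemma rconv_posneg k f (t : R) : (forall s, 0 <= k s) ->
  rconv k f t = fine (econv (EFin \o k) (EFin \o f^\+%R) t
                      - econv (EFin \o k) (EFin \o f^\-%R) t)%E.
Proof.
move=> k0; rewrite /rconv /Rintegral integralE.
congr (fine (_ - _)%E); apply: eq_integral => s _ /=.
  by rewrite funeposE /funrpos/= EFin_max maxe_pMr ?lee_fin// mule0 EFinM.
by rewrite funenegE /funrneg/= EFin_max maxe_pMr ?lee_fin// mule0 -EFinM mulrN.
Qed.

Lemma L1_rconv k f : (forall s, 0 <= k s) -> L1 k -> L1 f -> L1 (rconv k f).
Proof.
move=> k0 ik if_.
have mk := L1_measurable ik; have mf := L1_measurable if_.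
have H : mu.-integrable setT (econv (EFin \o k) (EFin \o (Num.norm \o f))).
  apply: L1_econv => //; last exact: integrable_norm.
  by move=> s; rewrite lee_fin/=.
apply: (le_integrable _ _ _ H) => //.
  apply/measurable_EFinP.
  rewrite (_ : rconv k f = fine \o (econv (EFin \o k) (EFin \o f^\+%R)
                      \- econv (EFin \o k) (EFin \o f^\-%R))%E); last first.
    by apply/funext => t; exact: rconv_posneg.
  apply: measurableT_comp => //.
  apply: emeasurable_funB; apply: measurable_econv => //.
  - exact/measurable_EFinP.
  - by apply/measurable_EFinP; exact: measurable_funrpos.
  - by move=> s; rewrite lee_fin.
  - exact/measurable_EFinP.
  - by apply/measurable_EFinP; exact: measurable_funrneg.
  - by move=> s; rewrite lee_fin.
move=> t _.
rewrite [leRHS]gee0_abs; last by apply: econv_ge0 => s; rewrite lee_fin/=.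
apply: (@le_trans _ _ `|\int[mu]_s (k (t - s) * f s)%:E|%E).
  by rewrite /= /rconv /Rintegral; case: (integral _ _ _) => //=; rewrite ?leey.
apply: (le_trans (le_abse_integral _ _ _)) => //.
  by apply/measurable_EFinP; exact: measurable_rconv_section.
rewrite le_eqVlt; apply/orP; left; apply/eqP.
by apply: eq_integral => s _ /=; rewrite normrM ger0_norm.
Qed.

Lemma ae_rconv_linear k f g (c d : R) : (forall s, 0 <= k s) ->
  L1 k -> L1 f -> L1 g ->
  {ae mu, forall t : R, rconv k (fun s => c * f s + d * g s) t =
                        c * rconv k f t + d * rconv k g t}.
Proof.
move=> k0 ik if_ ig.
apply: filterS2 (ae_rconv_integrable k0 ik if_)
  (ae_rconv_integrable k0 ik ig) => t itf itg.
rewrite /rconv -!RintegralZl// -RintegralD//; last 2 first.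
- exact: (integrableZl measurableT c itf).
- exact: (integrableZl measurableT d itg).
by apply: eq_Rintegral => s _ /=; ring.
Qed.

Lemma rconv_ae_eq k f g (t : R) : L1 k -> L1 f -> L1 g ->
  {ae mu, forall s : R, f s = g s} -> rconv k f t = rconv k g t.
Proof.
move=> ik if_ ig fg.
have mk := L1_measurable ik; have mf := L1_measurable if_.
have mg := L1_measurable ig.
rewrite /rconv /Rintegral; congr fine; apply: ae_eq_integral => //.
- by apply/measurable_EFinP; exact: measurable_rconv_section.
- by apply/measurable_EFinP; exact: measurable_rconv_section.
- by apply: filterS fg => s fg _; rewrite /= fg.
Qed.

(** For a nonnegative f the only difference with [econvA] is that the inner
    convolution is replaced by its finite part, which changes it on a null set
    that the outer integral does not see. *)
Lemma ge0_rconvA k1 k2 k f (t : R) :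
  (forall s, 0 <= k1 s) -> (forall s, 0 <= k2 s) -> (forall s, 0 <= f s) ->
  L1 k1 -> L1 k2 -> L1 f ->
  econv (EFin \o k1) (EFin \o k2) = EFin \o k ->
  rconv k1 (rconv k2 f) t = rconv k f t.
Proof.
move=> k10 k20 f0 ik1 ik2 if_ k12.
have mk1 := measurable_int _ ik1; have mk2 := measurable_int _ ik2.
have mf := measurable_int _ if_.
have H : mu.-integrable setT (econv (EFin \o k2) (EFin \o f)).
  by apply: L1_econv => // s; rewrite lee_fin.
rewrite [RHS]/rconv /Rintegral -/(econv (EFin \o k) (EFin \o f) t) -k12.
rewrite -econvA//; try by move=> s; rewrite lee_fin.
rewrite /rconv {1}/Rintegral; congr fine; apply: ae_eq_integral => //.
- apply/measurable_EFinP; apply: measurable_rconv_section.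
    exact/measurable_EFinP.
  by apply: L1_measurable; exact: L1_rconv.
- by apply: measurable_econv_section => //; exact: measurable_int H.
- apply: filterS (integrable_ae _ H) => // s /(_ I) fint _ /=.
  by rewrite EFinM; congr (_ * _)%E; rewrite -[RHS]fineK.
Qed.

Lemma ae_rconvA k1 k2 k f :
  (forall s, 0 <= k1 s) -> (forall s, 0 <= k2 s) -> (forall s, 0 <= k s) ->
  L1 k1 -> L1 k2 -> L1 k -> L1 f ->
  econv (EFin \o k1) (EFin \o k2) = EFin \o k ->
  {ae mu, forall t : R, rconv k1 (rconv k2 f) t = rconv k f t}.
Proof.
move=> k10 k20 k0 ik1 ik2 ik if_ k12.
have ifp := integrable_funrpos measurableT if_.
have ifn := integrable_funrneg measurableT if_.
(* The coefficients 1 and -1 put the decomposition in the form of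
   [ae_rconv_linear]. *)
have fE : f = (fun s => 1 * f^\+ s + (- 1) * f^\- s).
  apply/funext => s; rewrite mul1r mulN1r.
  by rewrite -[LHS](congr1 (fun h => h s) (funrposBneg f)).
have i2p := L1_rconv k20 ik2 ifp; have i2n := L1_rconv k20 ik2 ifn.
have i2D : L1 (fun s => 1 * rconv k2 f^\+ s + (- 1) * rconv k2 f^\- s).
  have := integrableD measurableT (integrableZl measurableT 1 i2p)
    (integrableZl measurableT (- 1) i2n).
  by apply: eq_integrable.
have E1 t : rconv k1 (rconv k2 f) t =
    rconv k1 (fun s => 1 * rconv k2 f^\+ s + (- 1) * rconv k2 f^\- s) t.
  apply: rconv_ae_eq => //; first exact: L1_rconv.
  by have := ae_rconv_linear 1 (- 1) k20 ik2 ifp ifn; rewrite -fE.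
have A1 := ae_rconv_linear 1 (- 1) k10 ik1 i2p i2n.
have A2 := ae_rconv_linear 1 (- 1) k0 ik ifp ifn.
apply: filterS2 A1 A2 => t; rewrite -fE => A1 ->; rewrite E1 A1.
by rewrite !(@ge0_rconvA k1 k2 k).
Qed.

End real_convolution.

(** * Riemann-Liouville integrals as convolutions *)

Section riemann_liouville.
Context (R : realType).
Notation mu := (@lebesgue_measure R).
Notation L1 f := (mu.-integrable setT (EFin \o f)).
Implicit Types f g h : R -> R.

(** Positive factors commute with the integral even when h is not integrable,
    since the infinite values and their default are preserved. This makes
    [RLint_rconv] valid at every t. *)
Lemma Rintegral_gt0Zl (D : set (measurableTypeR R)) h (c : R) :
  measurable D -> measurable_fun D h -> 0 < c ->
  \int[mu]_(s in D) (c * h s) = c * \int[mu]_(s in D) h s.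
Proof.
move=> mD mh c0.
have mEh : measurable_fun D (EFin \o h) by exact/measurable_EFinP.
rewrite /Rintegral integralE.
have -> : (fun s => (c * h s)%:E) = (fun s => c%:E * (EFin \o h) s)%E.
  by apply/funext => s; rewrite EFinM.
rewrite ge0_funeposM ?ge0_funenegM ?(ltW c0)//.
rewrite !ge0_integralZl ?lee_fin ?(ltW c0)//; last 2 first.
- exact: measurable_funeneg.
- exact: measurable_funepos.
rewrite [in RHS]integralE.
have : (0 <= \int[mu]_(s in D) (EFin \o h)^\+ s)%E by exact: integral_ge0.
have : (0 <= \int[mu]_(s in D) (EFin \o h)^\- s)%E by exact: integral_ge0.
case: (\int[mu]_(s in D) (EFin \o h)^\- s)%E => [y||] //;
  case: (\int[mu]_(s in D) (EFin \o h)^\+ s)%E => [x||] // _ _ /=;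
  rewrite ?gt0_muley ?lte_fin//= ?mulr0//.
by rewrite mulrBr.
Qed.

Lemma L1_gamma_density (a : R) : 0 < a <= 1 -> L1 (@gamma_density R a).
Proof.
move=> a01; apply/integrableP; split.
  by apply/measurable_EFinP; exact: measurable_gamma_density.
under eq_integral do rewrite gee0_abs ?lee_fin ?gamma_density_ge0//.
by rewrite integral_gamma_density// ltry.
Qed.

Lemma rconv_gamma_density_le0 (a t : R) F : t <= 0 ->
  (forall s, s <= 0 -> F s = 0) -> rconv (@gamma_density R a) F t = 0.
Proof.
move=> t0 F0; rewrite /rconv /Rintegral integral0_eq// => s _.
have [s0|s0] := leP (s : R) 0; first by rewrite F0// mulr0.
rewrite /gamma_density /gamma_kernel /powR_pos ifF ?mul0r ?mulr0 ?mul0r//.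
by apply/negbTE; rewrite -leNgt; lra.
Qed.

(** The operator is causal: only the values of h on ]0, t[ matter, so F may be
    anything beyond t. This is what allows the lemma to be applied with F itself
    a convolution, which does not vanish outside the time domain. *)
Lemma RLint_rconv (nu t : R) h F : 0 < nu <= 1 ->
  measurable_fun setT F ->
  (forall s, 0 < s < t -> F s = expR (- s) * h s) ->
  (forall s, s <= 0 -> F s = 0) ->
  RLint nu h t = expR t * rconv (@gamma_density R nu) F t.
Proof.
move=> nu01 mF Fh F0; have G0 := Gamma_gt0 nu01.
have mk : measurable_fun setT
    (fun s : measurableTypeR R => (t - s) `^ (nu - 1) * (expR s * F s)).
  apply: measurable_funM.
    apply: (measurableT_comp (measurable_powR _)); exact: measurable_funB.
  by apply: measurable_funM => //; exact: measurable_expR.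
have mh : measurable_fun `]0, t[%classic
    (fun s : measurableTypeR R => (t - s) `^ (nu - 1) * h s).
  apply: eq_measurable_fun (measurable_funTS mk) => s.
  rewrite inE/= in_itv/= => s0t.
  by rewrite Fh// (mulrA (expR s)) -expRD subrr expR0 mul1r.
have -> : rconv (@gamma_density R nu) F t =
    \int[mu]_(s in `]0, t[)
      ((Gamma nu)^-1 * expR (- t) * ((t - s) `^ (nu - 1) * h s)).
  rewrite [RHS]Rintegral_mkcond; apply: eq_Rintegral => s _.
  rewrite patchE mem_setE in_itv/=; case: ifPn => [s0t|].
    have /andP[s0 st] := s0t.
    rewrite Fh// /gamma_density /gamma_kernel /powR_pos subr_gt0 st.
    rewrite (_ : - t = - (t - s) + - s); last by ring.
    by rewrite expRD; ring.
  rewrite negb_and -!leNgt => /orP[s0|ts]; first by rewrite F0// mulr0.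
  rewrite /gamma_density /gamma_kernel /powR_pos subr_gt0 ltNge ts/=.
  by rewrite mul0r mulr0 mul0r.
rewrite Rintegral_gt0Zl//; last by rewrite mulr_gt0 ?invr_gt0 ?expR_gt0.
rewrite /RLint {1}/Rintegral integral_itv_bndoo; last exact/measurable_EFinP.
rewrite -/(Rintegral _ _ _).
have et1 : expR t * expR (- t) = 1 by rewrite -expRD subrr expR0.
by rewrite -[LHS]mul1r -et1; ring.
Qed.

Lemma measurable_time_domain (T : \bar R) :
  measurable (time_domain T : set (measurableTypeR R)).
Proof.
case: T => [r||].
- rewrite (_ : time_domain _ = `]0, r[%classic)//.
  apply/seteqP; split => s; rewrite /time_domain/= in_itv/= lte_fin.
    by case=> -> ->.
  by case/andP.
- rewrite (_ : time_domain _ = `]0, +oo[%classic)//.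
  apply/seteqP; split => s; rewrite /time_domain/= in_itv/= andbT ?ltry.
    by case.
  by [].
- rewrite (_ : time_domain _ = set0)//.
  by apply/seteqP; split => s //= -[_]; rewrite ltNge leNye.
Qed.

Lemma time_domainS (T : \bar R) (s t : R) :
  time_domain T t -> 0 < s < t -> time_domain T s.
Proof.
move=> [t0 tT] /andP[s0 st]; split => //.
by apply: lt_trans tT; rewrite lte_fin.
Qed.

(** Linearity and the semigroup law in the single form in which every iterated
    operator of the theorem is expanded. *)
Lemma ae_RLint_linear (T : \bar R) (a b c d : R) f :
  0 < a -> 0 < b -> a + b <= 1 ->
  mu.-integrable (time_domain T) (EFin \o f) ->
  {ae mu, forall t : R, time_domain T t ->
    RLint a (fun s => c * f s + d * RLint b f s) t =
    c * RLint a f t + d * RLint (a + b) f t}.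
Proof.
move=> a0 b0 ab1 if_.
have a01 : 0 < a <= 1 by lra.
have b01 : 0 < b <= 1 by lra.
have ab01 : 0 < a + b <= 1 by lra.
have mD := measurable_time_domain T.
pose F := (fun s => expR (- s) * f s) \_ (time_domain T).
have FD s : time_domain T s -> F s = expR (- s) * f s.
  by move=> Ds; rewrite /F patchE mem_set.
have F0 s : s <= 0 -> F s = 0.
  by move=> s0; rewrite /F patchE memNset// => -[]; rewrite ltNge s0.
have iF : L1 F.
  rewrite /F -restrict_EFin.
  have : mu.-integrable (time_domain T) (EFin \o (fun s => expR (- s) * f s)).
    apply: (le_integrable mD _ _ if_).
      apply/measurable_EFinP; apply: measurable_funM.
        by apply: measurable_funTS; apply: measurableT_comp => //;
          exact: measurable_expR.
      by apply/measurable_EFinP; exact: measurable_int if_.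
    move=> s [s0 _] /=; rewrite lee_fin normrM ler_piMl//.
    by rewrite ger0_norm ?expR_ge0// -expR0 ler_expR; lra.
  by move/(integrable_mkcond _ mD).
have mF := L1_measurable iF.
have ga0 := fun s => gamma_density_ge0 s a01.
have gb0 := fun s => gamma_density_ge0 s b01.
have gab0 := fun s => gamma_density_ge0 s ab01.
have ia := L1_gamma_density a01; have ib := L1_gamma_density b01.
have iab := L1_gamma_density ab01.
have iC := L1_rconv gb0 ib iF.
have A1 := ae_rconv_linear c d ga0 ia iF iC.
have A2 := ae_rconvA ga0 gb0 gab0 ia ib iab iF (econv_gamma_density a0 b0 ab1).
apply: filterS2 A1 A2 => t A1 A2 Dt.
rewrite (@RLint_rconv a t _
    (fun s => c * F s + d * rconv (@gamma_density R b) F s))//; first last.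
- by move=> s s0; rewrite F0// rconv_gamma_density_le0// !mulr0 addr0.
- move=> s s0t; have Ds := time_domainS Dt s0t.
  rewrite FD// (@RLint_rconv b s f F)//.
    have e1 : expR (- s) * expR s = 1 by rewrite -expRD addNr expR0.
    by rewrite -[X in _ + X = _]mul1r -e1; ring.
  by move=> u u0s; rewrite FD//; exact: time_domainS u0s.
- by apply: measurable_funD; apply: measurable_funM => //;
    exact: L1_measurable iC.
have FDt s : 0 < s < t -> F s = expR (- s) * f s.
  by move=> s0t; rewrite FD//; exact: time_domainS s0t.
rewrite A1 A2 (@RLint_rconv a t f F)// (@RLint_rconv (a + b) t f F)//.
by move: (rconv _ F t) (rconv _ F t) => x y; ring.
Qed.

End riemann_liouville.

Unset Implicit Arguments.

Theorem mainTheorem9 (R : realType) (B : R -> R) (T : \bar R)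
    (alpha beta : R) (f : R -> R)
    (hB : normalisation B) (hT : (0 < T)%E)
    (halpha : 0 < alpha < 1) (hbeta : 0 < beta < 1)
    (hab : alpha + beta < 1)
    (hf : (@lebesgue_measure R).-integrable (time_domain T) (EFin \o f)) :
  let ae_equal (g h : R -> R) :=
    ae_eq (@lebesgue_measure R) (time_domain T) g h in
  let condition :=
    ae_equal
      (fun t =>
         (alpha * beta / (B alpha * B beta)
            - (alpha + beta) / B (alpha + beta)) * RLint (alpha + beta) f t
         + alpha * (1 - beta) / (B alpha * B beta) * RLint alpha f t
         + beta * (1 - alpha) / (B alpha * B beta) * RLint beta f t
         + ((1 - alpha) * (1 - beta) / (B alpha * B beta)
            - (1 - alpha - beta) / B (alpha + beta)) * f t)
      (fun _ => 0) in
  (ae_equal (ABint B alpha (ABint B beta f)) (ABint B (alpha + beta) f)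
     <-> condition)
  /\
  (B alpha * B beta = B (alpha + beta) ->
   (condition <->
    ae_equal
      (RLaffine (alpha - 1) beta alpha (RLaffine (beta - 1) alpha beta f))
      (RLint (alpha + beta) f))).
Proof.
move=> ae_equal condition.
have [a0 a1] : 0 < alpha /\ alpha < 1 by apply/andP.
have [b0 b1] : 0 < beta /\ beta < 1 by apply/andP.
have AB := @ae_RLint_linear R T alpha beta
  ((1 - beta) / B beta) (beta / B beta) f a0 b0 (ltW hab) hf.
split.
  split; apply: filterS2 AB => t AB H Dt.
    move: (H Dt); rewrite /ABint AB// => /eqP; rewrite -subr_eq0 => /eqP <-.
    rewrite !invfM.
    move: (RLint _ f t) (RLint _ f t) (RLint _ f t) => x y z; ring.
  apply/eqP; rewrite -subr_eq0; apply/eqP; rewrite -[RHS](H Dt) /ABint AB//.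
  rewrite !invfM.
  move: (RLint _ f t) (RLint _ f t) (RLint _ f t) => x y z; ring.
move=> BB.
have Bab : B (alpha + beta) != 0.
  have [Bpos _ _] := hB.
  by rewrite gt_eqF// Bpos// in_itv/=; lra.
have BA := @ae_RLint_linear R T beta alpha (- beta) (beta - 1) f b0 a0.
rewrite addrC in BA; have {}BA := BA (ltW hab) hf.
have innerE : RLaffine (beta - 1) alpha beta f =
    (fun s => - beta * f s + (beta - 1) * RLint alpha f s).
  by apply/funext => s; rewrite /RLaffine; ring.
split; apply: filterS2 BA => t BA H Dt.
  have := congr1 (fun x => B (alpha + beta) * x) (H Dt).
  rewrite mulr0 BB => {}H.
  apply/eqP; rewrite -subr_eq0; apply/eqP; rewrite -[RHS]H.
  rewrite {1}/RLaffine innerE BA//.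
  move: (RLint _ f t) (RLint _ f t) (RLint _ f t) => x y z.
  by move: (B (alpha + beta)) Bab => v v0; field.
apply: (mulfI Bab); rewrite mulr0.
move: (H Dt); rewrite {1}/RLaffine innerE BA// => /eqP.
rewrite -subr_eq0 => /eqP <-; rewrite BB.
move: (RLint _ f t) (RLint _ f t) (RLint _ f t) => x y z.
by move: (B (alpha + beta)) Bab => v v0; field.
Qed.
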